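(* Let $s$ be a state at a program position $p$ whose instruction is $\mathtt{store\ ty}\ t\mathtt{,\ ty*\ pa}$ (with $t\in\mathcal V_{\mathcal P}\cup\mathbb N$, $\mathtt{pa}\in\mathcal V_{\mathcal P}$), and let $c$ be a concrete state represented by $s$. Let $s'$ be the state resulting from $s$ by applying the list extension rule, and let $c'$ be the concrete state resulting from $c$ by applying the concrete store rule (both rules defined in the context). Then $c'$ is represented by $s'$.
   Context: Setting. There are disjoint infinite sets $\mathcal{V}_{\mathcal P}$ (program variables) and $\mathcal{V}_{\mathit{sym}}$ (symbolic variables). Integers are treated as unbounded and unsigned. Every LLVM type $\mathtt{ty}$ has a size $\mathit{size}(\mathtt{ty})\in\mathbb N_{>0}$ in bytes; $\mathtt{ty*}$ is the pointer type to $\mathtt{ty}$ and $\mathtt{i8}$ is the byte type. A program position is a pair $p=(b,i)$ of a basic block and an instruction index, and $p^+=(b,i+1)$. States. A state is either the error state $\mathit{ERR}$ or a tuple $s=(p,\mathit{LV},\mathit{AL},\mathit{PT},\mathit{LI},\mathit{KB})$ where $p$ is a program position; $\mathit{LV}:\mathcal V_{\mathcal P}\rightharpoonup\mathcal V_{\mathit{sym}}$ is a partial injective function (identified with the set of equations $\mathtt{x}=\mathit{LV}(\mathtt{x})$, and extended by $\mathit{LV}(n)=n$ for $n\in\mathbb N$); $\mathit{AL}$ is a set of allocations $[\![v_1,v_2]\!]$ with $v_1,v_2\in\mathcal V_{\mathit{sym}}$; $\mathit{PT}$ is a set of points-to entries $v_1\hookrightarrow_{\mathtt{ty}}v_2$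 with $v_1,v_2\in\mathcal V_{\mathit{sym}}$; $\mathit{LI}$ is a set of list invariants $v_{\mathit{ad}}\hookrightarrow^{v_\ell}_{\mathtt{ty}}[(\mathit{off}_i:\mathtt{ty}_i:v_i..\hat v_i)]_{i=1}^n$ with $n\ge 1$, $v_{\mathit{ad}},v_\ell,v_i,\hat v_i\in\mathcal V_{\mathit{sym}}$, $\mathit{off}_i\in\mathbb N$, LLVM types $\mathtt{ty},\mathtt{ty}_i$, and exactly one index $j$ (the recursive field) with $\mathtt{ty}_j=\mathtt{ty*}$; $\mathit{KB}$ is a set of quantifier-free integer arithmetic formulas over $\mathcal V_{\mathit{sym}}$ (sets of formulas are read as conjunctions). $\mathcal V_{\mathit{sym}}(s)$ is the set of symbolic variables occurring in $s$; a variable is fresh if it does not occur in the state. ''$\models\varphi$'' means validity over the integers. State formula. $\langle s\rangle$ is the smallest set of formulas that contains $\mathit{KB}$ and: $v_1\ge1\wedge v_1\le v_2$ for each $[\![v_1,v_2]\!]\in\mathit{AL}$; $v_2<w_1\vee w_2<v_1$ for all $[\![v_1,v_2]\!],[\![w_1,w_2]\!]\in\mathit{AL}$ with $(v_1,v_2)\ne(w_1,w_2)$; $v_1\ge1$ for each $(v_1\hookrightarrow_{\mathtt{ty}}v_2)\in\mathit{PT}$; $v_2=w_2$ for $(v_1\hookrightarrow_{\mathtt{ty}}v_2),(w_1\hookrightarrow_{\mathtt{ty}}w_2)\in\mathit{PT}$ with $\models\langle s\rangle\Rightarrow v_1=w_1$; $v_1\ne w_1$ for such entries with $\models\langle s\rangle\Rightarrow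 v_2\ne w_2$; and for each list invariant $v_{\mathit{ad}}\hookrightarrow^{v_\ell}_{\mathtt{ty}}[(\mathit{off}_i:\mathtt{ty}_i:v_i..\hat v_i)]_{i=1}^n\in\mathit{LI}$ with recursive field $j$: $v_\ell\ge1\wedge v_{\mathit{ad}}\ge1$; $\bigwedge_{i=1}^n v_i=\hat v_i$ if $\models\langle s\rangle\Rightarrow v_\ell=1$; $v_j\ge1$ if $\models\langle s\rangle\Rightarrow v_\ell\ge2$; $v_\ell\ge2$ if there is $1\le k\le n$ with $\models\langle s\rangle\Rightarrow v_k\ne\hat v_k$. Concrete states. A state $c$ is concrete iff $c=\mathit{ERR}$ or $c=(p,\mathit{LV},\mathit{AL},\mathit{PT},\emptyset,\mathit{KB})$ where $\langle c\rangle$ is satisfiable; for every $v\in\mathcal V_{\mathit{sym}}(c)$ there is $n\in\mathbb N$ with $\models\langle c\rangle\Rightarrow v=n$; all entries of $\mathit{PT}$ have type $\mathtt{i8}$; for every $[\![v_1,v_2]\!]\in\mathit{AL}$ and every $n$ with $\models\langle c\rangle\Rightarrow v_1\le n\le v_2$ there is $(w_1\hookrightarrow_{\mathtt{i8}}w_2)\in\mathit{PT}$ with $\models\langle c\rangle\Rightarrow w_1=n$ and $\models\langle c\rangle\Rightarrow w_2=m$ for some $m\in[0,2^8-1]$; and every $(w_1\hookrightarrow_{\mathtt{i8}}w_2)\in\mathit{PT}$ satisfies $\models\langle c\rangle\Rightarrow v_1\le w_1\le v_2$ for some $[\![v_1,v_2]\!]\in\mathit{AL}$. For a concrete $c\ne\mathit{ERR}$: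 $\mathit{as}^c(\mathtt{x})=n$ where $\models\langle c\rangle\Rightarrow\mathit{LV}(\mathtt x)=n$ (for $\mathtt x\in\mathrm{dom}(\mathit{LV})$), and $\mathit{mem}^c:\mathbb N_{>0}\rightharpoonup[0,2^8-1]$ is defined at $n$ iff some $(w_1\hookrightarrow_{\mathtt{i8}}w_2)\in\mathit{PT}$ has $\models\langle c\rangle\Rightarrow w_1=n$, and then $\mathit{mem}^c(n)=m$ where $\models\langle c\rangle\Rightarrow w_2=m$. Separation logic. For $\mathit{as}:\mathcal V_{\mathcal P}\to\mathbb N$ and $\mathit{mem}:\mathbb N_{>0}\rightharpoonup[0,2^8-1]$, $(\mathit{as},\mathit{mem})\models\varphi$ iff $\mathit{mem}\models\mathit{as}(\varphi)$ (program variables replaced by their values); free symbolic variables are implicitly universally quantified over $\mathbb N$; arithmetic and first-order connectives are as usual. $\mathit{mem}\models n_1\hookrightarrow n_2$ iff $\mathit{mem}(n_1)=n_2$; $\mathit{mem}\models n_1\hookrightarrow_0 n_2$ always; $\mathit{mem}\models n_1\hookrightarrow_{n+1}n_2$ iff $\mathit{mem}\models n_1\hookrightarrow(n_2\bmod 2^8)$ and $\mathit{mem}\models (n_1+1)\hookrightarrow_n(n_2\operatorname{div}2^8)$. $\mathit{mem}\models\varphi_1*\varphi_2$ iff $\mathit{mem}=\mathit{mem}_1\uplus\mathit{mem}_2$ with disjoint domains, $\mathit{mem}_1\models\varphi_1$, $\mathit{mem}_2\models\varphi_2$; the empty separating conjunction is $\mathit{true}$. List predicate: for $\mathit{bs},\ell,n_{\mathit{ad}},s_i\in\mathbb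 N_{>0}$, $\mathit{off}_i,m_i,\hat m_i\in\mathbb N$, $1\le j\le n$: $\mathit{mem}\models\mathit{li}_{\mathit{bs},j}(1,n_{\mathit{ad}},[(\mathit{off}_i:s_i:m_i..\hat m_i)]_{i=1}^n)$ iff $\mathit{mem}\models\forall x\exists y.\,(n_{\mathit{ad}}\le x\le n_{\mathit{ad}}+\mathit{bs}-1)\Rightarrow x\hookrightarrow y$ and for all $i$: $m_i=\hat m_i$ and $\mathit{mem}\models n_{\mathit{ad}}+\mathit{off}_i\hookrightarrow_{s_i}m_i$; for $\ell>1$, $\mathit{mem}\models\mathit{li}_{\mathit{bs},j}(\ell,n_{\mathit{ad}},[(\mathit{off}_i:s_i:m_i..\hat m_i)]_{i=1}^n)$ iff $\mathit{mem}\models(\forall x\exists y.\,(n_{\mathit{ad}}\le x\le n_{\mathit{ad}}+\mathit{bs}-1)\Rightarrow x\hookrightarrow y)*\mathit{li}_{\mathit{bs},j}(\ell-1,m_j,[(\mathit{off}_i:s_i:\overline{m_i}..\hat m_i)]_{i=1}^n)$ for some $\overline{m_i}\in\mathbb N$, and $\mathit{mem}\models n_{\mathit{ad}}+\mathit{off}_i\hookrightarrow_{s_i}m_i$ for all $i$. Define $\langle[\![v_1,v_2]\!]\rangle_{\mathit{SL}}=\forall x\exists y.\,(v_1\le x\le v_2)\Rightarrow x\hookrightarrow y$, $\langle v_1\hookrightarrow_{\mathtt{ty}}v_2\rangle_{\mathit{SL}}=v_1\hookrightarrow_{\mathit{size}(\mathtt{ty})}v_2$, $\langle v_{\mathit{ad}}\hookrightarrow^{v_\ell}_{\mathtt{ty}}[(\mathit{off}_i:\mathtt{ty}_i:v_i..\hat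 v_i)]_{i=1}^n\rangle_{\mathit{SL}}=\mathit{li}_{\mathit{size}(\mathtt{ty}),j}(v_\ell,v_{\mathit{ad}},[(\mathit{off}_i:\mathit{size}(\mathtt{ty}_i):v_i..\hat v_i)]_{i=1}^n)$ ($j$ the recursive field), and $\langle s\rangle_{\mathit{SL}}=\langle s\rangle\wedge\mathit{LV}\wedge\big(((\ast_{\varphi\in\mathit{AL}}\langle\varphi\rangle_{\mathit{SL}})\wedge(\bigwedge_{\varphi\in\mathit{PT}}\langle\varphi\rangle_{\mathit{SL}}))\ast(\ast_{\varphi\in\mathit{LI}}\langle\varphi\rangle_{\mathit{SL}})\big)$. Representation. A concrete state $c=(p,\mathit{LV}^c,\mathit{AL}^c,\mathit{PT}^c,\emptyset,\mathit{KB}^c)$ is represented by $s=(p,\mathit{LV}^s,\mathit{AL}^s,\mathit{PT}^s,\mathit{LI}^s,\mathit{KB}^s)$ (same position) iff $\mathrm{dom}(\mathit{LV}^c)=\mathrm{dom}(\mathit{LV}^s)$ and there is $\sigma:\mathcal V_{\mathit{sym}}\to\mathbb N$ such that: $(\mathit{as}^c,\mathit{mem}^c)\models\sigma(\langle s\rangle_{\mathit{SL}})$; for every $[\![v_1,v_2]\!]\in\mathit{AL}^s$ there is $[\![w_1,w_2]\!]\in\mathit{AL}^c$ with $\models\langle c\rangle\Rightarrow w_1=\sigma(v_1)\wedge w_2=\sigma(v_2)$; and for every $v_{\mathit{ad}}\hookrightarrow^{v_\ell}_{\mathtt{ty}}[(\mathit{off}_i:\mathtt{ty}_i:v_i..\hat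 v_i)]_{i=1}^n\in\mathit{LI}^s$ with recursive field $j$ there are $[\![w^{\mathit{start}}_k,w^{\mathit{end}}_k]\!]\in\mathit{AL}^c$ for $1\le k\le\sigma(v_\ell)$ such that, with $m^{\mathit{start}}_k,m^{\mathit{end}}_k$ the numbers with $\models\langle c\rangle\Rightarrow w^{\mathit{start}}_k=m^{\mathit{start}}_k$ and $\models\langle c\rangle\Rightarrow w^{\mathit{end}}_k=m^{\mathit{end}}_k$, $(\mathit{as}^c,\mathit{mem}^c)\models\bigwedge_{k=1}^{\sigma(v_\ell)}(m^{\mathit{end}}_k-m^{\mathit{start}}_k=\mathit{size}(\mathtt{ty})-1)\wedge\sigma(v_{\mathit{ad}})=m^{\mathit{start}}_1\wedge\bigwedge_{k=1}^{\sigma(v_\ell)-1}m^{\mathit{start}}_k+\mathit{off}_j\hookrightarrow_{\mathit{size}(\mathtt{ty*})}m^{\mathit{start}}_{k+1}$. $\mathit{ERR}$ is represented only by $\mathit{ERR}$. List extension rule (instruction $\mathtt{store\ ty}\ t\mathtt{,\ ty*\ pa}$ at $p$). From $s=(p,\mathit{LV},\mathit{AL},\mathit{PT},\mathit{LI},\mathit{KB})$ it yields $s'=(p^+,\mathit{LV},\mathit{AL}\setminus\{[\![v^{\mathit{start}},v^{\mathit{end}}]\!]\},\mathit{PT}',(\mathit{LI}\setminus\{l\})\cup\{l'\},\mathit{KB}')$ provided: there is $l=(v_{\mathit{ad}}\hookrightarrow^{v_\ell}_{\mathtt{lty}}[(\mathit{off}_i:\mathtt{lty}_i:w_i..\hat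 w_i)]_{i=1}^n)\in\mathit{LI}$ with $\mathtt{lty}_j=\mathtt{lty*}$; there is $[\![v^{\mathit{start}},v^{\mathit{end}}]\!]\in\mathit{AL}$ with $\models\langle s\rangle\Rightarrow v^{\mathit{end}}=v^{\mathit{start}}+\mathit{size}(\mathtt{lty})-1$; there is $1\le m\le n$ with $\mathtt{ty}=\mathtt{lty}_m$ and $\models\langle s\rangle\Rightarrow\mathit{LV}(\mathtt{pa})=v^{\mathit{start}}+\mathit{off}_m$; for all $i\ne m$ there are $v^{\mathit{start}}_i,v_i\in\mathcal V_{\mathit{sym}}$ with $\models\langle s\rangle\Rightarrow v^{\mathit{start}}_i=v^{\mathit{start}}+\mathit{off}_i$ and $(v^{\mathit{start}}_i\hookrightarrow_{\mathtt{lty}_i}v_i)\in\mathit{PT}$; $\models\langle s\rangle\Rightarrow v_{\mathit{ad}}=v_j$ if $m\ne j$, and $\models\langle s\rangle\Rightarrow v_{\mathit{ad}}=\mathit{LV}(t)$ if $m=j$; $\mathit{PT}'=\{(x_1\hookrightarrow_{\mathtt{sy}}x_2)\in\mathit{PT}\mid\ \models\langle s\rangle\Rightarrow(v^{\mathit{end}}<x_1)\vee(x_1+\mathit{size}(\mathtt{sy})-1<v^{\mathit{start}})\}$; $l'=(v^{\mathit{start}}\hookrightarrow^{v'_\ell}_{\mathtt{lty}}[(\mathit{off}_i:\mathtt{lty}_i:v_i..\hat w_i)]_{i=1}^n)$; $\mathit{KB}'=\mathit{KB}\cup\{v_m=\mathit{LV}(t),\ v'_\ell=v_\ell+1\}$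 with $v_m,v'_\ell$ fresh. Concrete store rule (instruction $\mathtt{store\ ty}\ t\mathtt{,\ ty*\ pa}$ at $p$). From $s=(p,\mathit{LV},\mathit{AL},\mathit{PT},\emptyset,\mathit{KB})$ it yields $s'=(p^+,\mathit{LV},\mathit{AL},\mathit{PT}',\emptyset,\mathit{KB}')$ provided: there is $[\![w_1,w_2]\!]\in\mathit{AL}$ with $\models\langle s\rangle\Rightarrow w_1\le\mathit{LV}(\mathtt{pa})\wedge\mathit{LV}(\mathtt{pa})+\mathit{size}(\mathtt{ty})-1\le w_2$; there are $(y_0\hookrightarrow_{\mathtt{i8}}z_0),\dots,(y_{\mathit{size}(\mathtt{ty})-1}\hookrightarrow_{\mathtt{i8}}z_{\mathit{size}(\mathtt{ty})-1})\in\mathit{PT}$ with $\models\langle s\rangle\Rightarrow\mathit{LV}(\mathtt{pa})=y_0\wedge\bigwedge_{1\le i\le\mathit{size}(\mathtt{ty})-1}y_i=y_0+i$; $\mathit{PT}'$ is $\mathit{PT}$ with these entries replaced by $(y_i\hookrightarrow_{\mathtt{i8}}v_i)$ for $0\le i\le\mathit{size}(\mathtt{ty})-1$; $\mathit{KB}'=\mathit{KB}\cup\{v_i=u_i\mid0\le i\le\mathit{size}(\mathtt{ty})-1\}$ with $u_i=(\mathit{LV}(t)\operatorname{div}2^{8i})\bmod 2^8$ and fresh $v_0,\dots,v_{\mathit{size}(\mathtt{ty})-1}\in\mathcal V_{\mathit{sym}}$.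
   Formalization: Formal version assumes the list fields lie within size(lty) and do not overlap, that all addresses in mem^c are below 2^(8·size(ty* )) for every pointer type, and that the concrete store removes every PT entry for a written byte, aliases included; the literal claim fails without these. *)

(* Defs.v *)
From mathcomp Require Import all_boot all_order all_algebra.
From mathcomp Require Import boolp classical_sets cardinality.

Set Implicit Arguments.
Unset Strict Implicit.
Unset Printing Implicit Defensive.

Local Open Scope classical_set_scope.

(* Disjointness of the two kinds of variables is enforced by typing. *)
Record llvm := LLVM {
  pvar : Type;
  svar : Type;
  pvar_infinite : infinite_set [set: pvar];
  svar_infinite : infinite_set [set: svar];
  ty : Type;
  size_of : ty -> nat;
  size_of_gt0 : forall T, 0 < size_of T;
  ptr : ty -> ty;
  i8 : ty;
  size_of_i8 : size_of i8 = 1;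
  block_name : Type }.

Definition position (L : llvm) : Type := (block_name L * nat)%type.
Definition next_pos (L : llvm) (p : position L) : position L := (p.1, p.2.+1).

Inductive operand (L : llvm) := OVar of pvar L | ONat of nat.

(* [Store T t pa] is the instruction store T t, T* pa *)
Inductive instruction (L : llvm) :=
  | Store of ty L & operand L & pvar L
  | OtherInstruction.

Definition program (L : llvm) : Type := position L -> instruction L.

Inductive term (L : llvm) :=
  | TVar of svar L
  | TInt of int
  | TAdd of term L & term L
  | TSub of term L & term L
  | TMul of term L & term L
  | TDiv of term L & term L
  | TMod of term L & term L.

Inductive formula (L : llvm) :=
  | FTrue
  | FEq of term L & term L
  | FLe of term L & term L
  | FLt of term L & term L
  | FNot of formula L
  | FAnd of formula L & formula L
  | FOr of formula L & formula L.

Arguments OtherInstruction {L}.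
Arguments ONat {L} _.
Arguments TInt {L} _.
Arguments FTrue {L}.

Definition TNat (L : llvm) (n : nat) : term L := TInt (Posz n).
Arguments TNat {L} n.

Declare Scope qf_scope.
Delimit Scope qf_scope with qf.
Bind Scope qf_scope with term formula.
Notation "a + b" := (TAdd a b) : qf_scope.
Notation "a - b" := (TSub a b) : qf_scope.
Notation "a == b" := (FEq a b) : qf_scope.
Notation "a != b" := (FNot (FEq a b)) : qf_scope.
Notation "a <= b" := (FLe a b) : qf_scope.
Notation "a < b" := (FLt a b) : qf_scope.
Notation "A /\ B" := (FAnd A B) : qf_scope.
Notation "A \/ B" := (FOr A B) : qf_scope.
Coercion TVar : svar >-> term.

Fixpoint eval_term (L : llvm) (a : svar L -> int) (t : term L) : int :=
  match t with
  | TVar v => a v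
  | TInt z => z
  | TAdd t1 t2 => (eval_term a t1 + eval_term a t2)%R
  | TSub t1 t2 => (eval_term a t1 - eval_term a t2)%R
  | TMul t1 t2 => (eval_term a t1 * eval_term a t2)%R
  | TDiv t1 t2 => (eval_term a t1 %/ eval_term a t2)%Z
  | TMod t1 t2 => (eval_term a t1 %% eval_term a t2)%Z
  end.

Fixpoint eval (L : llvm) (a : svar L -> int) (phi : formula L) : Prop :=
  match phi with
  | FTrue => True
  | FEq t1 t2 => eval_term a t1 = eval_term a t2
  | FLe t1 t2 => (eval_term a t1 <= eval_term a t2)%R
  | FLt t1 t2 => (eval_term a t1 < eval_term a t2)%R
  | FNot A => ~ eval a A
  | FAnd A B => eval a A /\ eval a B
  | FOr A B => eval a A \/ eval a B
  end.

Fixpoint term_vars (L : llvm) (t : term L) : set (svar L) :=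
  match t with
  | TVar v => [set v]
  | TInt _ => set0
  | TAdd t1 t2 | TSub t1 t2 | TMul t1 t2 | TDiv t1 t2 | TMod t1 t2 =>
      term_vars t1 `|` term_vars t2
  end.

Fixpoint formula_vars (L : llvm) (phi : formula L) : set (svar L) :=
  match phi with
  | FTrue => set0
  | FEq t1 t2 | FLe t1 t2 | FLt t1 t2 => term_vars t1 `|` term_vars t2
  | FNot A => formula_vars A
  | FAnd A B | FOr A B => formula_vars A `|` formula_vars B
  end.

Definition models (L : llvm) (a : svar L -> int) (F : set (formula L)) : Prop :=
  forall phi, F phi -> eval a phi.

(* validity of F => phi over the integers *)
Definition entails (L : llvm) (F : set (formula L)) (phi : formula L) : Prop :=
  forall a, models a F -> eval a phi.

Record points_to (L : llvm) := PointsTo {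
  pt_addr : svar L;
  pt_ty : ty L;
  pt_val : svar L }.

Record field (L : llvm) := Field {
  f_off : nat;
  f_ty : ty L;
  f_first : svar L;    (* value of the field in the first list element *)
  f_last : svar L }.   (* value of the field in the last list element *)

(* Fields are indexed by 0, ..., li_n - 1; li_rec is the recursive field. *)
Record list_inv (L : llvm) := ListInv {
  li_addr : svar L;
  li_len : svar L;
  li_ty : ty L;
  li_n : nat;
  li_field : 'I_li_n -> field L;
  li_rec : 'I_li_n }.

Arguments PointsTo {L} _ _ _.
Arguments Field {L} _ _ _ _.
Arguments ListInv {L} _ _ _ _ _ _.
Arguments li_field {L} l _.

Record state_tuple (L : llvm) := StateTuple {
  st_pos : position L;
  st_LV : pvar L -> option (svar L);
  st_AL : set (svar L * svar L);
  st_PT : set (points_to L);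
  st_LI : set (list_inv L);
  st_KB : set (formula L) }.

Inductive state (L : llvm) := ERR | Tuple of state_tuple L.
Coercion Tuple : state_tuple >-> state.

(* The offsets are those of the fields of the struct type li_ty: the fields lie
   inside the li_ty-sized element and do not overlap. *)
Definition struct_layout (L : llvm) (l : list_inv L) : Prop :=
  (forall i, f_off (li_field l i) + size_of (f_ty (li_field l i))
             <= size_of (li_ty l)) /\
  (forall i k, i <> k ->
     f_off (li_field l i) + size_of (f_ty (li_field l i)) <= f_off (li_field l k)
     \/
     f_off (li_field l k) + size_of (f_ty (li_field l k)) <= f_off (li_field l i)).

Definition list_inv_wf (L : llvm) (l : list_inv L) : Prop :=
  (forall i, f_ty (li_field l i) = ptr (li_ty l) <-> i = li_rec l) /\
  struct_layout l.

Definition state_wf (L : llvm) (s : state_tuple L) : Prop :=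
  (forall x y v, st_LV s x = Some v -> st_LV s y = Some v -> x = y) /\
  (forall l, st_LI s l -> list_inv_wf l).

(* LV extended by LV(n) = n *)
Definition lookup (L : llvm) (s : state_tuple L) (t : operand L) :
    option (term L) :=
  match t with
  | OVar x => omap (@TVar L) (st_LV s x)
  | ONat n => Some (TNat n)
  end.

Definition state_vars (L : llvm) (s : state_tuple L) : set (svar L) :=
  [set v |
    (exists x, st_LV s x = Some v) \/
    (exists2 a, st_AL s a & v = a.1 \/ v = a.2) \/
    (exists2 e, st_PT s e & v = pt_addr e \/ v = pt_val e) \/
    (exists2 l, st_LI s l &
       v = li_addr l \/ v = li_len l \/
       exists i, v = f_first (li_field l i) \/ v = f_last (li_field l i)) \/
    (exists2 phi, st_KB s phi & formula_vars phi v)].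

Definition fresh (L : llvm) (s : state_tuple L) (v : svar L) : Prop :=
  ~ state_vars s v.

Definition FAll (L : llvm) (n : nat) (A : 'I_n -> formula L) : formula L :=
  foldr (@FAnd L) FTrue [seq A i | i <- enum 'I_n].

(* The generation rules (other than KB) of the state formula, relative to the
   set F of formulas against which entailments are checked. *)
Inductive sf_rule (L : llvm) (s : state_tuple L) (F : set (formula L)) :
    formula L -> Prop :=
  | SF_alloc v1 v2 : st_AL s (v1, v2) ->
      sf_rule s F (TNat 1 <= v1 /\ v1 <= v2)%qf
  | SF_alloc_disj v1 v2 w1 w2 : st_AL s (v1, v2) -> st_AL s (w1, w2) ->
      (v1, v2) <> (w1, w2) ->
      sf_rule s F (v2 < w1 \/ w2 < v1)%qf
  | SF_pt v1 T v2 : st_PT s (PointsTo v1 T v2) ->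
      sf_rule s F (TNat 1 <= v1)%qf
  | SF_pt_eq v1 v2 w1 w2 T : st_PT s (PointsTo v1 T v2) ->
      st_PT s (PointsTo w1 T w2) -> entails F (v1 == w1)%qf ->
      sf_rule s F (v2 == w2)%qf
  | SF_pt_neq v1 v2 w1 w2 T : st_PT s (PointsTo v1 T v2) ->
      st_PT s (PointsTo w1 T w2) -> entails F (v2 != w2)%qf ->
      sf_rule s F (v1 != w1)%qf
  | SF_li l : st_LI s l ->
      sf_rule s F (TNat 1 <= li_len l /\ TNat 1 <= li_addr l)%qf
  | SF_li_one l : st_LI s l -> entails F (li_len l == TNat 1)%qf ->
      sf_rule s F (FAll (fun i : 'I_(li_n l) =>
        (f_first (li_field l i) == f_last (li_field l i))%qf))
  | SF_li_next l : st_LI s l -> entails F (TNat 2 <= li_len l)%qf ->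
      sf_rule s F (TNat 1 <= f_first (li_field l (li_rec l)))%qf
  | SF_li_long l i : st_LI s l ->
      entails F (f_first (li_field l i) != f_last (li_field l i))%qf ->
      sf_rule s F (TNat 2 <= li_len l)%qf.

Definition state_formula (L : llvm) (s : state_tuple L) : set (formula L) :=
  smallest (fun F => sf_rule s F `<=` F) (st_KB s).

Definition valid_in (L : llvm) (s : state_tuple L) (phi : formula L) : Prop :=
  entails (state_formula s) phi.

Definition concrete_tuple (L : llvm) (c : state_tuple L) : Prop :=
  [/\ st_LI c = set0 /\ (exists a, models a (state_formula c)),
      forall v, state_vars c v -> exists n, valid_in c (v == TNat n)%qf,
      forall e, st_PT c e -> pt_ty e = i8 L,
      forall v1 v2 n, st_AL c (v1, v2) ->
        valid_in c (v1 <= TNat n /\ TNat n <= v2)%qf ->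
        exists w1 w2 m, [/\ st_PT c (PointsTo w1 (i8 L) w2), m <= 2 ^ 8 - 1,
          valid_in c (w1 == TNat n)%qf & valid_in c (w2 == TNat m)%qf]
    & forall w1 w2, st_PT c (PointsTo w1 (i8 L) w2) ->
        exists v1 v2, st_AL c (v1, v2) /\
          valid_in c (v1 <= w1 /\ w1 <= v2)%qf].

Definition concrete (L : llvm) (c : state L) : Prop :=
  if c is Tuple c' then concrete_tuple c' else True.

(* The value outside the domain of LV is irrelevant (0 here). *)
Definition as_of (L : llvm) (c : state_tuple L) (x : pvar L) : nat :=
  xget 0 [set n | exists2 v, st_LV c x = Some v & valid_in c (v == TNat n)%qf].

(* Heaps are partial functions; those of concrete states, and hence all their
   subheaps, are defined at positive addresses only and hold bytes. *)
Definition heap : Type := nat -> option nat.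
Definition hprop : Type := heap -> Prop.

Definition mem_of (L : llvm) (c : state_tuple L) : heap := fun n =>
  xget None [set o | exists w1 w2 m,
    [/\ st_PT c (PointsTo w1 (i8 L) w2), valid_in c (w1 == TNat n)%qf,
        valid_in c (w2 == TNat m)%qf & o = Some m]].

Definition hdisjoint (h1 h2 : heap) : Prop :=
  forall x, h1 x = None \/ h2 x = None.
Definition hsub (h1 h : heap) : Prop := forall x y, h1 x = Some y -> h x = Some y.
Definition hunion (h1 h2 : heap) : heap :=
  fun x => if h1 x is Some y then Some y else h2 x.

Definition star (P Q : hprop) : hprop := fun h =>
  exists h1 h2, [/\ hdisjoint h1 h2, h = hunion h1 h2, P h1 & Q h2].

(* Iterated separating conjunction over a set; for A = {a1, ..., ak} it is
   P a1 * ... * P ak * true, and in particular true if A is empty. *)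
Definition bigstar (T : Type) (A : set T) (P : T -> hprop) : hprop := fun h =>
  exists hs : T -> heap,
    [/\ forall a, A a -> hsub (hs a) h,
        forall a b, A a -> A b -> a <> b -> hdisjoint (hs a) (hs b)
      & forall a, A a -> P a (hs a)].

Fixpoint sl_pt (n1 k n2 : nat) : hprop := fun h =>
  if k is k'.+1
  then h n1 = Some (n2 %% 2 ^ 8) /\ sl_pt (n1 + 1) k' (n2 %/ 2 ^ 8) h
  else True.

Definition sl_block (lo hi : nat) : hprop := fun h =>
  forall x, exists y, lo <= x <= hi -> h x = Some y.

(* li_{bs,j}(len, addr, [(off i : sz i : m i .. mhat i)]_i), for len > 0 *)
Fixpoint sl_li (bs n : nat) (j : 'I_n) (off sz : 'I_n -> nat)
    (len addr : nat) (m mhat : 'I_n -> nat) : hprop := fun h =>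
  match len with
  | 0 => False
  | 1 => sl_block addr (addr + bs - 1) h /\
         (forall i, m i = mhat i /\ sl_pt (addr + off i) (sz i) (m i) h)
  | len'.+1 =>
      (exists mbar : 'I_n -> nat,
         star (sl_block addr (addr + bs - 1))
              (sl_li bs j off sz len' (m j) mbar mhat) h) /\
      (forall i, sl_pt (addr + off i) (sz i) (m i) h)
  end.

Definition sl_list_inv (L : llvm) (sigma : svar L -> nat) (l : list_inv L) :
    hprop :=
  sl_li (size_of (li_ty l)) (li_rec l)
    (fun i => f_off (li_field l i)) (fun i => size_of (f_ty (li_field l i)))
    (sigma (li_len l)) (sigma (li_addr l))
    (fun i => sigma (f_first (li_field l i)))
    (fun i => sigma (f_last (li_field l i))).

(* (asg, h) |= sigma(<s>_SL) *)
Definition sl_state (L : llvm) (s : state_tuple L) (sigma : svar L -> nat)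
    (asg : pvar L -> nat) : hprop := fun h =>
  [/\ models (fun v => Posz (sigma v)) (state_formula s),
      forall x v, st_LV s x = Some v -> asg x = sigma v
    & star
        (fun h1 =>
           bigstar (st_AL s) (fun a => sl_block (sigma a.1) (sigma a.2)) h1 /\
           forall e, st_PT s e ->
             sl_pt (sigma (pt_addr e)) (size_of (pt_ty e)) (sigma (pt_val e)) h1)
        (bigstar (st_LI s) (sl_list_inv sigma))
        h].

(* The list elements are numbered k = 1, ..., sigma(li_len l). *)
Definition list_allocated (L : llvm) (c : state_tuple L) (sigma : svar L -> nat)
    (l : list_inv L) : Prop :=
  let len := sigma (li_len l) in
  exists (wstart wend : nat -> svar L) (mstart mend : nat -> nat),
    [/\ forall k, 1 <= k <= len ->
          [/\ st_AL c (wstart k, wend k),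
              valid_in c (wstart k == TNat (mstart k))%qf,
              valid_in c (wend k == TNat (mend k))%qf
            & mend k - mstart k = size_of (li_ty l) - 1],
        sigma (li_addr l) = mstart 1
      & forall k, 1 <= k <= len - 1 ->
          sl_pt (mstart k + f_off (li_field l (li_rec l)))
            (size_of (ptr (li_ty l))) (mstart k.+1) (mem_of c)].

Definition represented_tuple (L : llvm) (c s : state_tuple L) : Prop :=
  [/\ st_pos c = st_pos s,
      forall x, isSome (st_LV c x) = isSome (st_LV s x)
    & exists sigma : svar L -> nat,
      [/\ sl_state s sigma (as_of c) (mem_of c),
          forall v1 v2, st_AL s (v1, v2) -> exists w1 w2, st_AL c (w1, w2) /\
            valid_in c (w1 == TNat (sigma v1) /\ w2 == TNat (sigma v2))%qf
        & forall l, st_LI s l -> list_allocated c sigma l]].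

(* meaningful for concrete c only *)
Definition represented (L : llvm) (c s : state L) : Prop :=
  match c, s with
  | Tuple c', Tuple s' => represented_tuple c' s'
  | ERR, ERR => True
  | _, _ => False
  end.

Definition list_extension (L : llvm) (P : program L)
    (T : ty L) (t : operand L) (pa : pvar L) (s s' : state_tuple L) : Prop :=
  P (st_pos s) = Store T t pa /\
  exists (l : list_inv L) (vstart vend vpa : svar L) (m : 'I_(li_n l))
         (tm : term L) (v : 'I_(li_n l) -> svar L) (vlen : svar L),
  let fld := li_field l in
  let lty := li_ty l in
  let l' := ListInv vstart vlen lty (li_n l)
    (fun i => Field (f_off (fld i)) (f_ty (fld i)) (v i) (f_last (fld i)))
    (li_rec l) in
  [/\ st_LI s l,
      st_AL s (vstart, vend) /\
        valid_in s (vend == vstart + TNat (size_of lty) - TNat 1)%qf,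
      [/\ T = f_ty (fld m), st_LV s pa = Some vpa
        & valid_in s (vpa == vstart + TNat (f_off (fld m)))%qf],
      forall i, i <> m -> exists vistart : svar L,
        valid_in s (vistart == vstart + TNat (f_off (fld i)))%qf /\
        st_PT s (PointsTo vistart (f_ty (fld i)) (v i))
    & [/\ lookup s t = Some tm,
      if m == li_rec l then valid_in s (li_addr l == tm)%qf
      else valid_in s (li_addr l == v (li_rec l))%qf,
      [/\ fresh s (v m), fresh s vlen & v m <> vlen]
    & s' = StateTuple (next_pos (st_pos s)) (st_LV s)
        (st_AL s `\ (vstart, vend))
        [set e | st_PT s e /\
           valid_in s (vend < pt_addr e \/
             pt_addr e + TNat (size_of (pt_ty e)) - TNat 1 < vstart)%qf]
        ((st_LI s `\ l) `|` [set l'])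
        (st_KB s `|` [set (v m == tm)%qf;
                          (vlen == li_len l + TNat 1)%qf])]].

(* PT may contain several entries for one byte, under different names of its
   address: replacing the entries of the written bytes removes all of them. *)
Definition concrete_store (L : llvm) (P : program L)
    (T : ty L) (t : operand L) (pa : pvar L) (c c' : state_tuple L) : Prop :=
  P (st_pos c) = Store T t pa /\
  exists (w1 w2 vpa : svar L) (tm : term L) (y z v : nat -> svar L),
  let u i := TMod (TDiv tm (TNat (2 ^ (8 * i)))) (TNat (2 ^ 8)) in
  [/\ st_LV c pa = Some vpa /\ lookup c t = Some tm,
      st_AL c (w1, w2) /\
        valid_in c (w1 <= vpa /\ vpa + TNat (size_of T) - TNat 1 <= w2)%qf,
      [/\ forall i, i < size_of T -> st_PT c (PointsTo (y i) (i8 L) (z i)),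
          valid_in c (vpa == y 0)%qf
        & forall i, 1 <= i <= size_of T - 1 ->
            valid_in c (y i == y 0 + TNat i)%qf],
      (forall i, i < size_of T -> fresh c (v i)) /\
        (forall i k, i < size_of T -> k < size_of T -> v i = v k -> i = k)
    & c' = StateTuple (next_pos (st_pos c)) (st_LV c) (st_AL c)
        ([set e | st_PT c e /\
            forall i, i < size_of T -> ~ valid_in c (pt_addr e == y i)%qf]
         `|` [set PointsTo (y i) (i8 L) (v i) | i in [set i | i < size_of T]])
        set0
        (st_KB c `|` [set (v i == u i)%qf | i in [set i | i < size_of T]])].

(* Pointers are wide enough for the addresses in use.  Points-to assertions only
   constrain values modulo 2^(8 * size), so that otherwise a stored pointer does
   not determine the address it points to. *)
Definition pointers_hold_addresses (L : llvm) (c : state_tuple L) : Prop :=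
  forall n T, mem_of c n <> None -> n < 2 ^ (8 * size_of (@ptr L T)).

(* Main.v *)
(* Let sigma witness that c is represented by s.  Extending sigma by the value
   of t for v_m and by sigma(v_l) + 1 for v'_l witnesses that c' is represented
   by s': the store only changes bytes of the block [v_start, v_end], so this
   block, with its new contents, moves from the part of the heap described by
   AL and PT to the part described by LI and becomes the new head of the list.
   The old lists stay allocated because their elements, reached by following
   pointers that hold all addresses in use, lie in the list part of the old
   heap, which is disjoint from the block.

   On the arithmetic side, the models of the old state formula, extended to
   the fresh variables, are models of the new one, for c' as well as for s'. *)
Require Import Defs.
From mathcomp Require Import all_boot all_order all_algebra.
From mathcomp Require Import boolp classical_sets cardinality.
From mathcomp Require Import zify.

Set Implicit Arguments.
Unset Strict Implicit.
Unset Printing Implicit Defensive.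

Local Open Scope classical_set_scope.

(** * Evaluation depends only on the occurring variables *)

Lemma eval_term_agree (L : llvm) (a b : svar L -> int) (t : term L) :
  (forall x, term_vars t x -> a x = b x) -> eval_term a t = eval_term b t.
Proof.
elim: t => //= [v ab|t1 IH1 t2 IH2 ab|t1 IH1 t2 IH2 ab|t1 IH1 t2 IH2 ab
  |t1 IH1 t2 IH2 ab|t1 IH1 t2 IH2 ab]; first exact: ab.
all: by rewrite IH1 ?IH2 // => x tx; apply: ab; [right|left].
Qed.

Lemma eval_agree (L : llvm) (a b : svar L -> int) (phi : formula L) :
  (forall x, formula_vars phi x -> a x = b x) -> eval a phi -> eval b phi.
Proof.
move=> ab; suff -> : eval a phi = eval b phi by [].
elim: phi ab => //= [t1 t2 ab|t1 t2 ab|t1 t2 ab|A IHA ab|A IHA B IHB ab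
  |A IHA B IHB ab].
1-3: by rewrite (@eval_term_agree _ a b t1) ?(@eval_term_agree _ a b t2) // => x tx;
  apply: ab; [right|left].
- by rewrite IHA.
- by rewrite IHA ?IHB // => x tx; apply: ab; [right|left].
- by rewrite IHA ?IHB // => x tx; apply: ab; [right|left].
Qed.

Lemma FAll_vars (L : llvm) n (A : 'I_n -> formula L) x :
  formula_vars (FAll A) x -> exists i, formula_vars (A i) x.
Proof.
by rewrite /FAll; elim: (enum 'I_n) => //= i r IH [Ax|/IH//]; exists i.
Qed.

(** * Variables of a state and closure of its state formula *)

Section StateVars.
Variables (L : llvm) (s : state_tuple L).

Lemma vars_LV x v : st_LV s x = Some v -> state_vars s v.
Proof. by move=> ?; left; exists x. Qed.

Lemma vars_AL v1 v2 : st_AL s (v1, v2) -> state_vars s v1 /\ state_vars s v2.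
Proof. by move=> ?; split; right; left; exists (v1, v2) => //; [left|right]. Qed.

Lemma vars_PT e : st_PT s e -> state_vars s (pt_addr e) /\ state_vars s (pt_val e).
Proof. by move=> ?; split; do 2 right; left; exists e => //; [left|right]. Qed.

Lemma vars_LI l : st_LI s l -> [/\ state_vars s (li_addr l),
  state_vars s (li_len l), forall i, state_vars s (f_first (li_field l i))
  & forall i, state_vars s (f_last (li_field l i))].
Proof.
move=> sl; split=> [||i|i]; do 3 right; left; exists l => //.
- by left.
- by right; left.
- by right; right; exists i; left.
- by right; right; exists i; right.
Qed.

Lemma vars_KB phi : st_KB s phi -> formula_vars phi `<=` state_vars s.
Proof. by move=> ? x ?; do 4 right; exists phi. Qed.

(** Side conditions of the rules mention only variables of [s], so entailments need to be
    transferred only for formulas over these. This leaves the values of fresh variables free to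
    change. *)
Lemma sf_rule_mono F G phi :
  (forall psi, formula_vars psi `<=` state_vars s -> entails F psi -> entails G psi) ->
  sf_rule s F phi -> sf_rule s G phi.
Proof.
move=> FG []; try by intros; econstructor; eauto.
- move=> v1 v2 w1 w2 T1 P1 P2 e; apply: (SF_pt_eq P1 P2); apply: FG => // x /=.
  have [? _] := vars_PT P1; have [? _] := vars_PT P2.
  by case=> ->.
- move=> v1 v2 w1 w2 T1 P1 P2 e; apply: (SF_pt_neq P1 P2); apply: FG => // x /=.
  have [_ ?] := vars_PT P1; have [_ ?] := vars_PT P2.
  by case=> ->.
- move=> l /[dup] Il /vars_LI[? ? ? ?] e; apply: SF_li_one => //; apply: FG => // x /=.
  by case=> // ->.
- move=> l /[dup] Il /vars_LI[? ? ? ?] e; apply: SF_li_next => //; apply: FG => // x /=.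
  by case=> // ->.
- move=> l i /[dup] Il /vars_LI[? ? ? ?] e; apply: (SF_li_long Il (i := i)).
  apply: FG => // x /=.
  by case=> // ->.
Qed.

Lemma state_formula_KB phi : st_KB s phi -> state_formula s phi.
Proof. by move=> ? F [_]; apply. Qed.

(** Knaster-Tarski: the rules are monotone in [F], since a larger set entails more, so the
    intersection of all closed sets containing [st_KB s] is itself closed. *)
Lemma state_formula_rule phi : sf_rule s (state_formula s) phi -> state_formula s phi.
Proof.
move=> r F [FF KF]; apply: (FF); apply: sf_rule_mono r => psi _ e a aF; apply: e => chi.
by move=> chis; apply: aF; apply: chis.
Qed.

Lemma state_formula_vars phi : state_formula s phi -> formula_vars phi `<=` state_vars s.
Proof.
move=> sphi; apply: (sphi [set psi | formula_vars psi `<=` state_vars s]).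
split; last exact: vars_KB.
move=> psi [].
- move=> v1 v2 /vars_AL[? ?] x /=; by case=> [[]|[]] // ->.
- move=> v1 v2 w1 w2 /vars_AL[? ?] /vars_AL[? ?] _ x /=; by case=> [[]|[]] // ->.
- move=> v1 T1 v2 /vars_PT[? ?] x /=; by case=> // ->.
- move=> v1 v2 w1 w2 T1 /vars_PT[? ?] /vars_PT[? ?] _ x /=; by case=> // ->.
- move=> v1 v2 w1 w2 T1 /vars_PT[? ?] /vars_PT[? ?] _ x /=; by case=> // ->.
- move=> l /vars_LI[? ? ? ?] x /=; by case=> [[]|[]] // ->.
- move=> l /vars_LI[? ? ? ?] _ x /FAll_vars[i] /=; by case=> // ->.
- move=> l /vars_LI[? ? ? ?] _ x /=; by case=> // ->.
- move=> l i /vars_LI[? ? ? ?] _ x /=; by case=> // ->.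
Qed.

End StateVars.

(** * State formulas and classes of models *)

Definition theory (L : llvm) (K : set (svar L -> int)) : set (formula L) :=
  [set phi | forall a, K a -> eval a phi].

Lemma entails_theory (L : llvm) (K : set (svar L -> int)) phi a :
  entails (theory K) phi -> K a -> eval a phi.
Proof. by move=> e Ka; apply: e => psi; apply. Qed.

(* The theory of K is then closed under the rules, whereas that of a single
   model need not be: the two equal values demanded by SF_pt_eq are only
   determined by the memory modulo a power of 2. *)
Lemma models_state_formula (L : llvm) (s : state_tuple L) (K : set (svar L -> int)) a :
  (forall phi, st_KB s phi -> theory K phi) ->
  (forall phi, sf_rule s (theory K) phi -> theory K phi) ->
  K a -> models a (state_formula s).
Proof. by move=> KB KR Ka phi sphi; apply: (sphi (theory K)) => //; split. Qed.

(** Up to the values of variables outside [s], [K] consists of all models of the state formula. Both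
    therefore entail the same formulas over the variables of [s], and the rules relative to
    [theory K] yield only members of the state formula. *)
Lemma theory_conservative (L : llvm) (s : state_tuple L) (K : set (svar L -> int)) phi :
  (forall a, K a -> models a (state_formula s)) ->
  (forall a, models a (state_formula s) ->
     exists2 b, K b & forall x, state_vars s x -> a x = b x) ->
  sf_rule s (theory K) phi -> theory K phi.
Proof.
move=> Ks ext r a Ka; apply: Ks Ka _ _; apply: state_formula_rule.
apply: sf_rule_mono r => psi psis e b /ext[b' Kb' bb'].
apply: eval_agree (entails_theory e Kb') => x /psis sx; by rewrite bb'.
Qed.

(** * Concrete states, evaluated in a single model *)

Section Concrete.
Variables (L : llvm) (c : state_tuple L).
Hypothesis cc : concrete_tuple c.
Variable (a : svar L -> int).
Hypothesis ac : models a (state_formula c).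

Lemma concrete_nat v : state_vars c v -> exists n, a v = Posz n.
Proof. by case: cc => _ d _ _ _ /d[n vn]; exists n; apply: vn. Qed.

Lemma concrete_agree b v : models b (state_formula c) -> state_vars c v -> a v = b v.
Proof.
move=> bc; case: cc => _ d _ _ _ /d[n vn].
by have /= -> := vn _ ac; have /= -> := vn _ bc.
Qed.

(** Each variable of a concrete state has the same value in all models, so truth in the one model
    [a] is already validity. *)
Lemma concrete_valid phi : formula_vars phi `<=` state_vars c ->
  eval a phi -> valid_in c phi.
Proof.
move=> sub e b bc; apply: eval_agree e => x /sub cx; exact: concrete_agree.
Qed.

Lemma valid_natE v n : state_vars c v -> valid_in c (v == TNat n)%qf <-> a v = Posz n.
Proof.
by move=> cv; split=> [/(_ _ ac)//|e]; apply: concrete_valid => // x /= [->|].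
Qed.

(** The rule [SF_pt_eq] applies because equality of the two addresses in [a] is valid. This makes
    [mem_of] single-valued even with several entries for one byte. *)
Lemma concrete_PT_fun v1 v2 w1 w2 :
  st_PT c (PointsTo v1 (i8 L) v2) -> st_PT c (PointsTo w1 (i8 L) w2) ->
  a v1 = a w1 -> a v2 = a w2.
Proof.
move=> P1 P2 e; apply: (ac (phi := (v2 == w2)%qf)); apply: state_formula_rule.
apply: (SF_pt_eq P1 P2); apply: concrete_valid => // x /=.
have [? _] := vars_PT P1; have [? _] := vars_PT P2.
by case=> ->.
Qed.

Lemma as_ofE x v n : st_LV c x = Some v -> a v = Posz n -> as_of c x = n.
Proof.
move=> xv vn; apply: xget_unique => /=.
  by exists v => //; apply/valid_natE => //; apply: vars_LV xv.
move=> k [v']; rewrite xv => -[<-] /(_ _ ac) /=; rewrite vn; by case.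
Qed.

Lemma as_ofP x v : st_LV c x = Some v -> a v = Posz (as_of c x).
Proof.
by move=> xv; have [n vn] := concrete_nat (vars_LV xv); rewrite (as_ofE xv vn).
Qed.

Lemma mem_ofP n m : mem_of c n = Some m <->
  exists w1 w2, [/\ st_PT c (PointsTo w1 (i8 L) w2), a w1 = Posz n & a w2 = Posz m].
Proof.
rewrite /mem_of; split.
  case: xgetP => // _ -> /= [w1 [w2 [k [P1 v1 v2 ->]]]] [<-]; exists w1, w2; split => //.
    exact: (v1 _ ac).
  exact: (v2 _ ac).
move=> [w1 [w2 [P1 e1 e2]]]; have [? ?] := vars_PT P1.
apply: xget_unique => /=.
  by exists w1, w2, m; split => //; apply/valid_natE.
move=> _ [v1 [v2 [k [P2 /(_ _ ac)/= f1 /(_ _ ac)/= f2 ->]]]].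
have := concrete_PT_fun P1 P2; rewrite e1 f1 e2 f2 => /(_ erefl) [->]//.
Qed.

Lemma mem_of_AL v1 v2 n (k : nat) : st_AL c (v1, v2) -> a v1 = Posz n -> a v2 = Posz k ->
  forall x, (n <= x <= k)%N -> mem_of c x <> None.
Proof.
move=> cA e1 e2 x xnk; have [? ?] := vars_AL cA.
have [_ _ _ + _] := cc.
move=> /(_ _ _ x cA) []; first apply: concrete_valid => [y|/=].
- by case=> [[->|]|[|->]].
- rewrite e1 e2; lia.
move=> w1 [w2 [m [P1 _ /(_ _ ac)/= f1 /(_ _ ac)/= f2]]].
by rewrite (_ : mem_of c x = Some m) //; apply/mem_ofP; exists w1, w2.
Qed.

End Concrete.

(** * Points-to assertions and the list predicate on heaps *)

Lemma sl_ptP n1 k n2 h : sl_pt n1 k n2 h <->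
  forall i, i < k -> h (n1 + i) = Some ((n2 %/ 2 ^ (8 * i)) %% 2 ^ 8).
Proof.
elim: k n1 n2 => [|k IH] n1 n2 //=.
split=> [[h0 /IH hk] [_|i ik]|hk].
- by rewrite muln0 expn0 divn1 addn0.
- by rewrite -[n1 + i.+1]/(n1 + (1 + i)) addnA hk // -divnMA -expnD mulnS.
- split; first by have := hk 0 isT; rewrite muln0 expn0 divn1 addn0.
  by apply/IH => i ik; rewrite -addnA hk // -divnMA -expnD mulnS.
Qed.

Lemma sl_pt_sub n1 k n2 (h h' : heap) :
  (forall i, i < k -> h (n1 + i) <> None -> h' (n1 + i) = h (n1 + i)) ->
  sl_pt n1 k n2 h -> sl_pt n1 k n2 h'.
Proof. by move=> hh' /sl_ptP p; apply/sl_ptP => i ik; rewrite hh' // p. Qed.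

(** The heap fixes the [k] lowest base-256 digits, and a number below [2 ^ (8 * k)] has no
    others. *)
Lemma sl_pt_inj n k x y h : sl_pt n k x h -> sl_pt n k y h ->
  x < 2 ^ (8 * k) -> y < 2 ^ (8 * k) -> x = y.
Proof.
elim: k n x y => [|k IH] n x y /=; first by rewrite muln0 expn0; lia.
move=> [hx px] [hy py] xk yk; rewrite (divn_eq x (2 ^ 8)) (divn_eq y (2 ^ 8)).
congr (_ * _ + _); last by move: hy; rewrite hx => -[].
by apply: IH px py _ _; rewrite ltn_divLR // -expnD addnC -mulnS.
Qed.

Lemma sl_block_def lo hi h x : sl_block lo hi h -> lo <= x <= hi -> h x <> None.
Proof. by move=> b xl; have [y ->] := b x. Qed.

Lemma sl_li_gt0 bs n (j : 'I_n) off sz len addr m mhat h :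
  sl_li bs j off sz len addr m mhat h -> 0 < len.
Proof. by case: len. Qed.

Lemma sl_li_block bs n (j : 'I_n) off sz len addr m mhat h :
  sl_li bs j off sz len addr m mhat h -> sl_block addr (addr + bs - 1) h.
Proof.
case: len => // -[[]//|len [[mbar [h1 [h2 [_ -> b _]]]] _]] x.
by have [y hy] := b x; exists y => /hy; rewrite /hunion => ->.
Qed.

(* Since the pointers of the list are wide enough to hold the addresses in use,
   following the stored pointers leads to the elements of the list predicate. *)
Lemma sl_li_chain bs n (j : 'I_n) off sz len addr m mhat (h H : heap) (q : nat -> nat) :
  0 < bs -> hsub h H ->
  (forall x, H x <> None -> x < 2 ^ (8 * sz j)) ->
  sl_li bs j off sz len addr m mhat h ->
  q 1 = addr ->
  (forall k, 1 <= k <= len -> H (q k) <> None) ->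
  (forall k, 1 <= k <= len - 1 -> sl_pt (q k + off j) (sz j) (q k.+1) H) ->
  forall k, 1 <= k <= len -> sl_block (q k) (q k + bs - 1) h.
Proof.
move=> bs0; elim: len addr m h q => [//|len IH] addr m h q hH Hb li q1 qH qp k.
case: k => [//|[|k]] kl; first by rewrite q1; apply: sl_li_block li.
case: len => [|len] in IH li qH qp kl *; first lia.
have [[mbar [h1 [h2 [dis eh _ li2]]]] pts] := li.
have {}li2 : sl_li bs j off sz len.+1 (m j) mbar mhat h2 by [].
have h2h : hsub h2 h.
  move=> x y h2x; rewrite eh /hunion; case: (dis x) => [-> //|]; by rewrite h2x.
have h2H : hsub h2 H by move=> x y /h2h /hH.
(* The same pointer field holds both numbers, and both are addresses in use, hence small enough for
   [sl_pt_inj]. *)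
have e2 : q 2 = m j.
  apply: (@sl_pt_inj (q 1 + off j) (sz j) _ _ H); first exact: qp.
  - rewrite q1; apply: sl_pt_sub (pts j) => i _.
    by case E: (h _) => [y|//] _; apply: hH E.
  - by apply: Hb; apply: qH.
  - apply: Hb; have [y] := sl_li_block li2 (m j).
    rewrite leqnn /= => h2y; rewrite (h2H _ y) // h2y //; lia.
have b := IH _ _ h2 (fun k => q k.+1) h2H Hb li2 e2 _ _ k.+1.
move=> x; have [] := b _ _ _ x.
- by move=> k' k'l; apply: qH; lia.
- by move=> k' k'l; apply: qp; lia.
- lia.
- by move=> y hy; exists y => /hy /h2h.
Qed.

(** * Effect of the concrete store on models and memory *)

Lemma lookup_vars (L : llvm) (s : state_tuple L) t tm :
  lookup s t = Some tm -> term_vars tm `<=` state_vars s.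
Proof.
case: t => [x|n] /=; last by case=> <-.
by case E: (st_LV s x) => [v|//] [<-] _ ->; apply: vars_LV E.
Qed.

Definition operand_val (L : llvm) (c : state_tuple L) (t : operand L) : nat :=
  match t with OVar x => as_of c x | ONat n => n end.

Definition stored (h : heap) (A k N : nat) : heap := fun n =>
  if A <= n < A + k then Some ((N %/ 2 ^ (8 * (n - A))) %% 2 ^ 8) else h n.

Lemma lookup_val (L : llvm) (c s : state_tuple L) t tm (a : svar L -> int) :
  (forall x v, st_LV s x = Some v -> a v = Posz (as_of c x)) ->
  lookup s t = Some tm -> eval_term a tm = Posz (operand_val c t).
Proof.
move=> aE; case: t => [x|n] /=; last by case=> <-.
by case E: (st_LV s x) => [v|//] [<-] /=; apply: aE.
Qed.

Section Store.
Variables (L : llvm) (P : program L) (T : ty L) (t : operand L) (pa : pvar L).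
Variables (c c' : state_tuple L).
Hypothesis cc : concrete_tuple c.
Hypothesis cc' : concrete_tuple c'.
Hypothesis st : concrete_store P T t pa c c'.

(** The byte names are fresh, so any model of [c] can be given the stored bytes as their values. The
    result satisfies both state formulas, so that addresses and contents in [c] and [c'] can be
    compared in one assignment. *)
Lemma store_model : exists a, [/\ models a (state_formula c),
  models a (state_formula c') & forall n,
  mem_of c' n = stored (mem_of c) (as_of c pa) (size_of T) (operand_val c t) n].
Proof.
have [_ [w1 [w2 [vpa [tm [y [z [v]]]]]]]] := st.
set u := fun i : nat => _.
case=> [[LVpa lk] [ALw vw] [PTy y0 yi] [fr inj] ec'].
have yE a i : models a (state_formula c) -> i < size_of T ->
    a (y i) = (a vpa + Posz i)%R.
  move=> ac; case: i => [_|i iT]; first by rewrite GRing.addr0; have /= := y0 _ ac.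
  have /= -> := yi i.+1 ltac:(lia) _ ac.
  by have /= -> := y0 _ ac.
have vy i : i < size_of T -> state_vars c (y i).
  by move=> /PTy /vars_PT[].
(* In a concrete state an equality that is not valid fails in every model, so surviving entries
   never alias a written byte. *)
have kept e : st_PT c e ->
    (forall i, i < size_of T -> ~ valid_in c (pt_addr e == y i)%qf) ->
    forall a i, models a (state_formula c) -> i < size_of T -> a (pt_addr e) <> a (y i).
  move=> ce ne a i ac iT eq; apply: (ne i iT); apply: (concrete_valid cc ac) => // x /=.
  have [? _] := vars_PT ce; have ? := vy i iT; by case=> ->.
have uv i : term_vars (u i) `<=` state_vars c.
  by move=> x /= [[/(lookup_vars lk)|]|].
pose K := [set a | models a (state_formula c) /\
                   forall i, i < size_of T -> a (v i) = eval_term a (u i)].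
have ext a : models a (state_formula c) ->
    exists2 b, K b & forall x, state_vars c x -> a x = b x.
  (* Freshness keeps [b] equal to [a] on the variables of [c]; injectivity of [v] makes the picked
     index unambiguous. *)
  move=> ac; pose b x := if [pick i : 'I_(size_of T) | `[< v i = x >]] is Some i
    then eval_term a (u i) else a x.
  have ab x : state_vars c x -> a x = b x.
    rewrite /b; case: pickP => // i /asboolP <- cx; by have := fr _ (ltn_ord i).
  exists b => //; split.
    move=> phi cphi; apply: eval_agree (ac _ cphi) => x /(state_formula_vars cphi).
    exact: ab.
  move=> i iT; rewrite -(@eval_term_agree _ a b (u i)); last by move=> x /uv/ab.
  rewrite {1}/b; case: pickP => [k /asboolP vki|/(_ (Ordinal iT))].
    by rewrite (inj _ _ (ltn_ord k) iT vki).
  by move=> /asboolP /=.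
have [a0 a0c] : exists a, models a (state_formula c) by case: cc => -[].
have [a Ka _] := ext _ a0c.
have ac : models a (state_formula c) by case: Ka.
have Kc b : K b -> models b (state_formula c) by case.
have Kc' b : K b -> models b (state_formula c').
  have old phi := @theory_conservative _ c K phi Kc ext.
  apply: models_state_formula => phi.
    rewrite ec' => -[cphi d [dc _]|[i iT <-] d [_ dv]].
      by apply: dc; apply: state_formula_KB.
    exact: dv.
  rewrite ec' => -[] /=.
  - by move=> v1 v2 h; apply: old; apply: SF_alloc.
  - by move=> v1 v2 w3 w4 h1 h2 d; apply: old; apply: SF_alloc_disj.
  - move=> v1 U v2 [[ce _]|[i iT [<- _ _]]]; apply: old; first exact: SF_pt ce.
    exact: SF_pt (PTy i iT).
  (* Each of the two entries is old or written. A mixed pair has different addresses by [kept]; two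
     written entries with equal addresses have the same index. *)
  - move=> v1 v2 v3 v4 U [[ce1 n1]|[i iT [ev1 eU ev2]]] [[ce2 n2]|[k kT [ev3 eU' ev4]]] e.
    + exact: (old _ (SF_pt_eq ce1 ce2 e)).
    + subst v3; exfalso; apply: (kept _ ce1 n1 a k ac kT); exact: (entails_theory e Ka).
    + subst v1; exfalso; apply: (kept _ ce2 n2 a i ac iT).
      by have /= := entails_theory e Ka.
    + subst; have /= := entails_theory e Ka; rewrite !yE // => ik.
      by have -> : i = k by lia.
  (* Mixed pairs satisfy the disequality by [kept]; for two written entries, equal addresses would
     give equal indices and hence equal values. *)
  - move=> v1 v2 v3 v4 U [[ce1 n1]|[i iT [ev1 eU ev2]]] [[ce2 n2]|[k kT [ev3 eU' ev4]]] e d Kd.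
    + exact: (old _ (SF_pt_neq ce1 ce2 e)).
    + subst v3; exact: (kept _ ce1 n1 d k (Kc _ Kd) kT).
    + subst v1 => /= /esym; exact: (kept _ ce2 n2 d i (Kc _ Kd) iT).
    + subst => /=; rewrite !yE //; try exact: Kc.
      move=> ik; have {}ik : i = k by lia.
      by subst; have /= := entails_theory e Ka.
  - by move=> l [].
  - by move=> l [].
  - by move=> l [].
  - by move=> l i [].
exists a; split => //; first exact: Kc'.
have ac' := Kc' _ Ka.
have aN : eval_term a tm = Posz (operand_val c t).
  by apply: lookup_val lk => x w; apply: as_ofP.
have apa : a vpa = Posz (as_of c pa) by apply: as_ofP LVpa.
have memE n m : mem_of c' n = Some m <->
    stored (mem_of c) (as_of c pa) (size_of T) (operand_val c t) n = Some m.
  rewrite (mem_ofP cc' ac') /stored ec' /=; case: ifP => nT; split.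
  - move=> [v1 [v2 [[[ce ne]|[i iT [ev1 ev2]]] /= e1 e2]]].
      exfalso; apply: (kept _ ce ne a (n - as_of c pa) ac); first lia.
      rewrite /= e1 yE //; lia.
    subst; move: e1 e2; rewrite yE // (proj2 Ka) //= aN apa divz_nat modz_nat => e1 [<-].
    by have -> : n - as_of c pa = i by lia.
  - have nT' : n - as_of c pa < size_of T by lia.
    move=> [<-]; exists (y (n - as_of c pa)), (v (n - as_of c pa)); split.
    + by right; exists (n - as_of c pa).
    + rewrite yE //; lia.
    + by rewrite (proj2 Ka) //= aN divz_nat modz_nat.
  - move=> [v1 [v2 [[[ce ne]|[i iT [ev1 ev2]]] /= e1 e2]]].
      by apply/(mem_ofP cc ac); exists v1, v2.
    subst; move: e1; rewrite yE //; lia.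
  - move=> /(mem_ofP cc ac)[v1 [v2 [ce e1 e2]]]; exists v1, v2; split => //.
    left; split => // i iT /(_ _ ac) /=; rewrite e1 yE //; lia.
move=> n; case E: (stored _ _ _ _ n) => [m|]; first exact/memE.
case E': (mem_of c' n) => [m|//]; move/memE: E'; by rewrite E.
Qed.

End Store.

(** * Arithmetic side of the list extension rule *)

Definition update2 (A B : Type) (f : A -> B) (x1 x2 : A) (y1 y2 : B) (x : A) : B :=
  if `[< x = x1 >] then y1 else if `[< x = x2 >] then y2 else f x.

Lemma update2_old (A B : Type) (f : A -> B) x1 x2 y1 y2 x :
  x <> x1 -> x <> x2 -> update2 f x1 x2 y1 y2 x = f x.
Proof. by move=> n1 n2; rewrite /update2 asboolF // asboolF. Qed.

Lemma update2_fst (A B : Type) (f : A -> B) x1 x2 y1 y2 :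
  update2 f x1 x2 y1 y2 x1 = y1.
Proof. by rewrite /update2 asboolT. Qed.

Lemma update2_snd (A B : Type) (f : A -> B) x1 x2 y1 y2 : x1 <> x2 ->
  update2 f x1 x2 y1 y2 x2 = y2.
Proof. by move=> n; rewrite /update2 asboolF 1?asboolT // => /esym. Qed.

Section Extension.
Variables (L : llvm) (s : state_tuple L) (l : list_inv L) (vstart vend : svar L).
Variables (m : 'I_(li_n l)) (tm : term L) (v : 'I_(li_n l) -> svar L) (vlen : svar L).

Definition extended_list : list_inv L :=
  ListInv vstart vlen (li_ty l) (li_n l)
    (fun i => Field (f_off (li_field l i)) (f_ty (li_field l i)) (v i)
                    (f_last (li_field l i)))
    (li_rec l).

Definition extended_state : state_tuple L :=
  StateTuple (next_pos (st_pos s)) (st_LV s) (st_AL s `\ (vstart, vend))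
    [set e | st_PT s e /\ valid_in s (vend < pt_addr e \/
       pt_addr e + TNat (size_of (pt_ty e)) - TNat 1 < vstart)%qf]
    ((st_LI s `\ l) `|` [set extended_list])
    (st_KB s `|` [set (v m == tm)%qf; (vlen == li_len l + TNat 1)%qf]).

Hypotheses (sl : st_LI s l) (sA : st_AL s (vstart, vend)).
Hypothesis tmv : term_vars tm `<=` state_vars s.
Hypothesis adj : if m == li_rec l then valid_in s (li_addr l == tm)%qf
                 else valid_in s (li_addr l == v (li_rec l))%qf.
Hypotheses (fr_vm : fresh s (v m)) (fr_vlen : fresh s vlen) (vm_vlen : v m <> vlen).

(** Removing allocations and points-to entries only removes rule instances, and the remaining old
    ones are covered by [theory_conservative]. For the new list, [vlen] is at least 2 throughout
    [K], the address is positive by [sA], and the recursive field equals the address of [l]. *)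
Lemma extended_state_models (a : svar L -> int) :
  models a (state_formula s) -> a (v m) = eval_term a tm ->
  a vlen = (a (li_len l) + 1)%R -> models a (state_formula extended_state).
Proof.
pose K := [set a | [/\ models a (state_formula s), a (v m) = eval_term a tm &
   a vlen = (a (li_len l) + 1)%R]].
have Ks d : K d -> models d (state_formula s) by case.
have ext d : models d (state_formula s) ->
    exists2 b, K b & forall x, state_vars s x -> d x = b x.
  move=> ds; pose b := update2 d (v m) vlen (eval_term d tm) (d (li_len l) + 1)%R.
  have db x : state_vars s x -> d x = b x.
    by move=> sx; rewrite /b update2_old // => xe; [apply: fr_vm|apply: fr_vlen];
      rewrite -xe.
  exists b => //; split.
  - move=> phi sphi; apply: eval_agree (ds _ sphi) => x /(state_formula_vars sphi).
    exact: db.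
  - by rewrite {1}/b update2_fst; apply: eval_term_agree => x /tmv/db.
  - by rewrite {1}/b update2_snd // db //; have [] := vars_LI sl.
have old phi := @theory_conservative _ s K phi Ks ext.
have len1 d : K d -> (1 <= d (li_len l))%R /\ (1 <= d (li_addr l))%R.
  by move=> Kd; have /= := old _ (SF_li _ sl) _ Kd.
have vlen2 d : K d -> (2 <= d vlen)%R.
  by move=> Kd; case: (Kd) => _ _ ->; have [] := len1 _ Kd; lia.
move=> as_ am alen; have {as_ am alen} Ka : K a by [].
apply: (models_state_formula (K := K)) Ka => phi.
  move=> [sphi d [ds _ _]|[->|->] d [ds /= ? ?] //].
  by apply: ds; apply: state_formula_KB.
case=> /=.
- by move=> v1 v2 [h _]; apply: old; apply: SF_alloc.
- by move=> v1 v2 w3 w4 [h1 _] [h2 _] d; apply: old; apply: SF_alloc_disj.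
- by move=> v1 U v2 [h _]; apply: old; apply: SF_pt h.
- by move=> v1 v2 v3 v4 U [h1 _] [h2 _] e; apply: old (SF_pt_eq h1 h2 e).
- by move=> v1 v2 v3 v4 U [h1 _] [h2 _] e; apply: old (SF_pt_neq h1 h2 e).
- move=> l0 [[h _]|->]; first by apply: old; apply: SF_li.
  move=> d Kd /=; have := vlen2 _ Kd.
  have /= [] := old _ (SF_alloc _ sA) _ Kd; lia.
- move=> l0 [[h _]|->] e; first by apply: old; apply: SF_li_one.
  (* For the new list the premise that [vlen] is 1 contradicts [vlen2]. *)
  by move=> d Kd; have := vlen2 _ Kd; have /= -> := entails_theory e Kd.
- move=> l0 [[h _]|->] e; first by apply: old; apply: SF_li_next.
  move=> d Kd /=; have [_] := len1 _ Kd.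
  move: adj; case: eqP => [<-|_] /(_ d (Ks _ Kd)) /= -> //.
  by case: Kd => _ ->.
- move=> l0 i [[h _]|eq] e; first by apply: old; apply: SF_li_long e.
  by move=> d Kd /=; rewrite eq /=; apply: vlen2.
Qed.

End Extension.

(** * Heaps after the store and survival of the old lists *)

Lemma stored_out (h : heap) A k N n : ~~ (A <= n < A + k) -> stored h A k N n = h n.
Proof. by rewrite /stored => /negbTE ->. Qed.

Lemma sl_pt_stored (h : heap) A k N : sl_pt A k N (stored h A k N).
Proof.
apply/sl_ptP => i ik; rewrite /stored leq_addr ltn_add2l ik /=.
by rewrite addKn.
Qed.

Lemma hsub_unionl h1 h2 : hsub h1 (hunion h1 h2).
Proof. by move=> x y; rewrite /hunion => ->. Qed.

Lemma hsub_unionr h1 h2 : hdisjoint h1 h2 -> hsub h2 (hunion h1 h2).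
Proof. by move=> d x y; rewrite /hunion; case: (d x) => ->. Qed.

(** Since [c] and [c'] agree on [h], it is enough that the pointer fields linking the allocated
    blocks lie in [h]. [sl_li_chain] places these blocks in [h], and the layout places each pointer
    field inside its block. *)
Lemma list_allocated_transfer (L : llvm) (c c' : state_tuple L) (sigma : svar L -> nat)
    (l : list_inv L) (h : heap) (a : svar L -> int) :
  concrete_tuple c -> concrete_tuple c' -> st_AL c' = st_AL c ->
  models a (state_formula c) -> models a (state_formula c') ->
  pointers_hold_addresses c -> list_inv_wf l ->
  hsub h (mem_of c) -> (forall x, h x <> None -> mem_of c' x = mem_of c x) ->
  sl_list_inv sigma l h ->
  list_allocated c sigma l -> list_allocated c' sigma l.
Proof.
move=> cc cc' eA ac ac' wide [frec [lay _]] hc hc' li [ws [we [ms [me [al e1 pts]]]]].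
exists ws, we, ms, me; split => // k kl.
  have [cA vs ve dk] := al k kl; rewrite eA; split => //.
    by apply/(valid_natE cc' ac'); [|exact: (vs _ ac)];
      move: cA; rewrite -eA => /vars_AL[].
  by apply/(valid_natE cc' ac'); [|exact: (ve _ ac)];
    move: cA; rewrite -eA => /vars_AL[].
have fj := (frec (li_rec l)).2 erefl.
have chain := sl_li_chain (size_of_gt0 (li_ty l)) hc _ li (esym e1) _ _ (k := k).
have b : sl_block (ms k) (ms k + size_of (li_ty l) - 1) h.
  apply: chain; last lia.
  - by rewrite fj => x; apply: wide.
  (* Allocations are nonempty, so each start [ms i] is an address in use. *)
  - move=> i il; have [cA vs ve _] := al i il.
    apply: (mem_of_AL cc ac cA (vs _ ac) (ve _ ac)); rewrite leqnn /=.
    have /= [_] := ac _ (state_formula_rule (SF_alloc _ cA)).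
    by have /= -> := vs _ ac; have /= -> := ve _ ac.
  - by rewrite fj.
apply: sl_pt_sub (pts k kl) => i ik _; apply: hc'; apply: sl_block_def b _.
have := lay (li_rec l); rewrite fj; lia.
Qed.

(** * Representation after a list extension *)

Theorem theorem3 (L : llvm) (P : program L) (T : ty L) (t : operand L)
  (pa : pvar L) (s s' c c' : state_tuple L)
  (s_state : state_wf s)
  (c_state : state_wf c)
  (c_concrete : concrete c)
  (c_addr : pointers_hold_addresses c)
  (c_s : represented c s)
  (s_s' : list_extension P T t pa s s')
  (c_c' : concrete_store P T t pa c c')
  (c'_concrete : concrete c') :
  represented c' s'.
Proof.
have [ecp ecLV ecA] : [/\ st_pos c' = next_pos (st_pos c), st_LV c' = st_LV c
    & st_AL c' = st_AL c].
  by case: c_c' => _ [? [? [? [? [? [? [? [_ _ _ _ ->]]]]]]]].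
have [a [ac ac' memE]] := store_model c_concrete c'_concrete c_c'.
have asE : as_of c' = as_of c.
  apply: funext => x; case E: (st_LV c x) => [w|]; last first.
    (* Outside the domain of [st_LV] both values are the default 0. *)
    by rewrite /as_of !xgetPN // => n [w]; rewrite ?ecLV E.
  by apply: (as_ofE c'_concrete ac' (v := w)); rewrite ?ecLV //; apply: as_ofP.
have [epos edom [sigma [[smod sLV [h1 [h2 [dis12 eh [[hs1 [sub1 dis1 blk1]] pt1]
  [hs2 [sub2 dis2 li2]]]]]] salloc slist]]] := c_s.
have [_ [l [vstart [vend [vpa [m [tm [v [vlen]]]]]]]]] := s_s'.
move=> /= [sl [sA vend_eq] [eT LVpa vpa_eq] others
  [lk adj [fr_vm fr_vlen vm_vlen] es']].
have {es'} -> : s' = extended_state s vstart vend m tm v vlen by [].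
set l' := extended_list vstart v vlen; set h := mem_of c in eh memE *.
set N := operand_val c t in memE; set B := sigma vstart in vend_eq *.
have [frec [lay sep]] := s_state.2 l sl.
have sz0 := size_of_gt0 (li_ty l).
have vendE : sigma vend = B + size_of (li_ty l) - 1.
  by have /= := vend_eq _ smod; lia.
have vpaE : as_of c pa = B + f_off (li_field l m).
  by rewrite (sLV _ _ LVpa); have /= := vpa_eq _ smod; lia.
pose inB x := B <= x <= sigma vend.
(* Only field [m] is written, and it lies inside the block. *)
have h'out x : ~~ inB x -> mem_of c' x = h x.
  move=> xB; rewrite memE stored_out // vpaE eT; have := lay m; move: xB.
  by rewrite /inB vendE; lia.
have h1B x : inB x -> h1 x <> None.
  move=> xB; have [y hy] := blk1 _ sA x; by rewrite (sub1 _ sA _ _ (hy xB)).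
have h2B x : inB x -> h2 x = None.
  by move=> /h1B; case: (dis12 x).
have sub1h : hsub h1 h by rewrite eh; apply: hsub_unionl.
have sub2h : hsub h2 h by rewrite eh; apply: hsub_unionr.
(* The cells of the block, with their contents in [c'], move from the first component to the
   second. *)
pose h1' x := if inB x then None else h1 x.
pose h2' x := if inB x then mem_of c' x else h2 x.
(* The new list owns the block together with the heap of [l]; all other lists keep theirs. *)
pose hs2' l0 := if `[< l0 = l' >] then fun x => if inB x then mem_of c' x else hs2 l x
  else hs2 l0.
have ntm : eval_term (fun x => Posz (sigma x)) tm = Posz N.
  by apply: lookup_val lk => x w /sLV ->.
pose sigma' := update2 sigma (v m) vlen N (sigma (li_len l)).+1.
have sig x : state_vars s x -> sigma' x = sigma x.
  by move=> sx; rewrite /sigma' update2_old // => xe; [apply: fr_vm|apply: fr_vlen];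
    rewrite -xe.
have sigm : sigma' (v m) = N by rewrite /sigma' update2_fst.
have siglen : sigma' vlen = (sigma (li_len l)).+1 by rewrite /sigma' update2_snd.
(* The fresh [vlen] occurs in [l'], so the case distinction in [hs2'] affects no old list. *)
have l'new : ~ st_LI s l'.
  by move=> sl'; apply: fr_vlen; have [_] := vars_LI sl'.
have tms := lookup_vars lk.
have [sad slen sfst slst] := vars_LI sl.
have sstart : state_vars s vstart by have [] := vars_AL sA.
(* The next pointer of the new head is either the value being stored or one already recorded in
   [st_PT s]; the rule equates it with the address of [l] in both cases. *)
have sigrec : sigma' (v (li_rec l)) = sigma (li_addr l).
  case: eqP adj => [<-|ne] /(_ _ smod) /=; first by rewrite sigm ntm => -[].
  by have [w [_ /vars_PT[_ /= /sig ->]]] := others _ (nesym ne); case.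
(* Field [m] holds the stored value. The other fields come from [st_PT s] and survive because fields
   do not overlap. *)
have l'pt i : sl_pt (B + f_off (li_field l i)) (size_of (f_ty (li_field l i)))
    (sigma' (v i)) (fun x => if inB x then mem_of c' x else hs2 l x).
  have inBi k : k < size_of (f_ty (li_field l i)) -> inB (B + f_off (li_field l i) + k).
    by move=> ki; rewrite /inB vendE; have := lay i; lia.
  have [im|/eqP im] := eqVneq i m.
    rewrite im sigm -vpaE -eT; apply: sl_pt_sub (sl_pt_stored h _ _ _) => k kT _.
    by have := inBi k; rewrite im -eT => /(_ kT) Bk; rewrite -memE vpaE Bk.
  have [w [/(_ _ smod)/= wE sPT]] := others _ im.
  have [_ /sig /= ->] := vars_PT sPT.
  have := pt1 _ sPT => /=; have -> : sigma w = B + f_off (li_field l i) by lia.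
  apply: sl_pt_sub => k ki; rewrite inBi //.
  case E: (h1 _) => [y|//] _; rewrite memE stored_out; first by rewrite (sub1h _ _ E).
  by rewrite vpaE eT; have := sep _ _ im; lia.
(* The old lists live in [h2], which is disjoint from the block. This includes [l], whose elements
   become the tail of [l']. *)
have list_keep l0 : st_LI s l0 -> list_allocated c' sigma l0.
  move=> sl0; apply: (list_allocated_transfer c_concrete c'_concrete ecA ac ac' c_addr
    (s_state.2 _ sl0) _ _ (li2 _ sl0) (slist _ sl0)).
  - by move=> x y /(sub2 _ sl0) /sub2h.
  - move=> x; case E: (hs2 l0 x) => [y|//] _; apply: h'out; apply/negP => /h2B.
    by rewrite (sub2 _ sl0 _ _ E).
have validc' w n : state_vars c' w -> a w = Posz n -> valid_in c' (w == TNat n)%qf.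
  by move=> cw e; apply/(valid_natE c'_concrete ac').
have alloc' v1 v2 : st_AL s (v1, v2) -> exists w1 w2, st_AL c' (w1, w2) /\
    valid_in c' (w1 == TNat (sigma v1) /\ w2 == TNat (sigma v2))%qf.
  move=> sA'; have [w1 [w2 [cA /(_ _ ac)/= [e1 e2]]]] := salloc _ _ sA'.
  rewrite -ecA in cA; have [? ?] := vars_AL cA.
  exists w1, w2; split => // d dc'; split; exact: (validc' _ _ _ _ _ dc').
split; first by rewrite ecp epos.
  by move=> x; rewrite ecLV edom.
exists sigma'; split.
- split.
  + apply: (@extended_state_models _ s l vstart vend m tm v vlen) => //.
    * move=> phi sphi; apply: eval_agree (smod _ sphi) => x.
      by move=> /(state_formula_vars sphi) /sig ->.
    * rewrite sigm -ntm; apply: eval_term_agree => x /tms /sig ->//.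
    * by rewrite siglen sig // -addn1.
  + by move=> x w /= sx; rewrite asE (sLV _ _ sx) sig //; apply: (vars_LV sx).
  exists h1', h2'; split.
  + by move=> x; rewrite /h1' /h2'; case: (inB x); [left|].
  + apply: funext => x; rewrite /hunion /h1' /h2'; case E: (inB x) => //.
    by rewrite h'out ?E // eh.
  + split.
    * exists hs1; split.
      - move=> a0 [sa0 na0] x y E; rewrite /h1' ifF; first exact: sub1 E.
        (* Distinct allocations of [s] own disjoint heaps, so the remaining ones avoid the block. *)
        apply/negP => xB; case: (dis1 _ _ sa0 sA na0 x); first by rewrite E.
        exact: sl_block_def (blk1 _ sA) xB.
      - by move=> a0 b0 [sa0 _] [sb0 _]; apply: dis1.
      - move=> [v1 v2] [sa0 _]; have [/sig -> /sig ->] := vars_AL sa0.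
        exact: blk1 sa0.
    * move=> e [se out]; have [/sig -> /sig ->] := vars_PT se.
      apply: sl_pt_sub (pt1 _ se) => i ie _; rewrite /h1' ifF //; apply/negP.
      (* The rule retains only points-to entries lying entirely outside the block. *)
      by have /= := out _ smod; rewrite /inB -/B; lia.
  + exists hs2'; split.
    * move=> l0 sl0 x y; rewrite /hs2' /h2'; case: asboolP => [_|ne].
        by case: (inB x) => //; apply: sub2.
      case: sl0 => [[sl0 _]|//]; move=> /(sub2 _ sl0) h2x; rewrite ifF //.
      by apply/negP => /h2B; rewrite h2x.
    * have dl' l0 : (st_LI s `\ l) l0 ->
          hdisjoint (hs2 l0) (fun x => if inB x then mem_of c' x else hs2 l x).
        move=> [sl0 ne] x; case: ifP => xB; last exact: dis2.
        left; case E: (hs2 l0 x) => [y|//].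
        by have := h2B _ xB; rewrite (sub2 _ sl0 _ _ E).
      move=> l0 l1 sl0 sl1 ne; rewrite /hs2'.
      case: asboolP sl0 => [e0|n0] sl0; case: asboolP sl1 => [e1|n1] sl1.
      - by case: ne; rewrite e0 e1.
      - by case: sl1 => // /dl' d x; case: (d x); [right|left].
      - by case: sl0 => // /dl'.
      - by case: sl0 sl1 => // -[sl0 _] [[sl1 _]|//]; apply: dis2.
    * move=> l0 [[sl0 ne]|->]; last first.
        rewrite /hs2' asboolT // /sl_list_inv /= siglen (sig vstart) // -/B.
        have := li2 _ sl; rewrite /sl_list_inv.
        have := sl_li_gt0 (li2 _ sl); case: (sigma (li_len l)) => // len _ lil.
        split; last exact: l'pt.
        (* The tail of the new list is [l], so the values in the first element of [l] serve as
           [mbar]. *)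
        exists (fun i => sigma (f_first (li_field l i))).
        exists (fun x => if inB x then mem_of c' x else None), (hs2 l); split.
        - move=> x; case: ifP => xB; [right|by left].
          case E: (hs2 l x) => [y|//].
          by have := h2B _ xB; rewrite (sub2 _ sl _ _ E).
        - apply: funext => x; rewrite /hunion; case: ifP => // xB.
          case E: (mem_of c' x) => [y//|].
          case E': (hs2 l x) => [y|//].
          by have := h2B _ xB; rewrite (sub2 _ sl _ _ E').
        - move=> x; case E: (mem_of c' x) => [y|].
            by exists y; rewrite -vendE -/(inB x) => ->.
          (* The 0 is arbitrary: every block cell is defined in [c'], being either just written or
             inherited from [h1]. *)
          exists 0; rewrite -vendE -/(inB x) => xB; move: E.
          rewrite memE /stored; case: ifP => // _.
          by case E1: (h1 x) (h1B _ xB) => [y|//] _; rewrite (sub1h _ _ E1).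
        - rewrite sigrec; move: lil; congr (sl_li _ _ _ _ _ _ _ _ _).
          by apply: funext => i; rewrite sig.
      rewrite /hs2' asboolF; last by move=> e0; apply: l'new; rewrite -e0.
      have [ad ln fs ls] := vars_LI sl0.
      have := li2 _ sl0; rewrite /sl_list_inv (sig (li_len l0)) // (sig (li_addr l0)) //.
      congr (sl_li _ _ _ _ _ _ _ _ _); apply: funext => i; by rewrite sig.
- move=> v1 v2 [sA' _]; have [/sig -> /sig ->] := vars_AL sA'; exact: alloc'.
- move=> l0 [[sl0 ne]|->].
    have [ad ln _ _] := vars_LI sl0.
    by rewrite /list_allocated (sig (li_len l0)) // (sig (li_addr l0)) //; apply: list_keep.
  have [ws [we [ms [me [al e1 pts]]]]] := list_keep _ sl.
  have [w1 [w2 [cA w12]]] := alloc' _ _ sA.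
  rewrite /list_allocated /= siglen (sig vstart) // -/B.
  (* The new block becomes element 1 and the old elements shift up by one; index 0 lies outside the
     numbering. *)
  exists (fun k => if k is k'.+2 then ws k'.+1 else w1),
    (fun k => if k is k'.+2 then we k'.+1 else w2),
    (fun k => if k is k'.+2 then ms k'.+1 else B),
    (fun k => if k is k'.+2 then me k'.+1 else sigma vend); split => //.
    move=> [//|[|k]] kl; last by apply: al; lia.
    by split => //; [move=> d /w12 []|move=> d /w12 []|rewrite vendE; lia].
  move=> [//|[|k]] kl; last by apply: pts; lia.
  (* The link from element 1 to element 2 is the recursive field of the new head, which by [sigrec]
     holds the address of [l]. *)
  rewrite -e1 -sigrec -((frec _).2 erefl).
  apply: sl_pt_sub (l'pt (li_rec l)) => i ik; rewrite ifT //.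
  by rewrite /inB vendE; have := lay (li_rec l); lia.
Qed.
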